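(* Let $m$ be a positive integer and $\lambda$ a nonzero real number. For integers $0\le i\le n$, $$V_{m,\lambda}(n,i)=\sum_{k=i}^{n}(-1)^{k-i}\binom{k}{i}m^{n-k}S_{1,\lambda/m}(n,k)\,\langle 1\rangle_{k-i,\lambda}.$$
   Context: For a nonzero real $\mu$: $(x)_{0,\mu}=1$, $(x)_{n,\mu}=x(x-\mu)\cdots(x-(n-1)\mu)$; $\langle x\rangle_{0,\mu}=1$, $\langle x\rangle_{n,\mu}=x(x+\mu)\cdots(x+(n-1)\mu)$; $(x)_n=(x)_{n,1}$. Degenerate Stirling numbers of the first kind: $(x)_n=\sum_{l=0}^{n}S_{1,\mu}(n,l)(x)_{l,\mu}$. Degenerate Whitney numbers of the first kind $V_{m,\lambda}(n,k)$: $m^{n}(x)_{n}=\sum_{k=0}^{n}V_{m,\lambda}(n,k)(mx+1)_{k,\lambda}$. *)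

(* Defs.v *)
From mathcomp Require Import all_boot all_order all_algebra.
From mathcomp Require Import boolp reals.
From mathcomp Require Import ring.
Set Implicit Arguments.
Unset Strict Implicit.
Unset Printing Implicit Defensive.
Import Order.TTheory GRing.Theory Num.Theory.
Local Open Scope ring_scope.

Definition falling (R : realType) (mu x : R) (n : nat) : R :=
  \prod_(0 <= j < n) (x - j%:R * mu).

Definition rising (R : realType) (mu x : R) (n : nat) : R :=
  \prod_(0 <= j < n) (x + j%:R * mu).

Definition is_stirling1 (R : realType) (mu : R) (S : nat -> nat -> R) : Prop :=
  forall (n : nat) (x : R),
    falling 1 x n = \sum_(0 <= l < n.+1) S n l * falling mu x l.

Definition is_whitney1 (R : realType) (m : nat) (lambda : R)
    (V : nat -> nat -> R) : Prop :=
  forall (n : nat) (x : R),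
    m%:R ^+ n * falling 1 x n
    = \sum_(0 <= k < n.+1) V n k * falling lambda (m%:R * x + 1) k.

Lemma falling_expansion (R : realType) (mu : R) (a : nat -> R) (n : nat) :
  exists c : nat -> R, forall y : R,
    \prod_(0 <= j < n) (y - a j) = \sum_(0 <= l < n.+1) c l * falling mu y l.
Proof.
elim: n => [|n [c IH]].
  exists (fun=> 1) => y.
  by rewrite big_nat1 /falling !big_geq // mulr1.
exists (fun l => (if l is l'.+1 then c l' else 0)
                 + (if (l <= n)%N then (l%:R * mu - a n) * c l else 0)) => y.
rewrite big_nat_recr //= IH big_distrl /=.
under [RHS]eq_bigr do rewrite mulrDl.
rewrite big_split /= [X in _ = X + _]big_nat_recl //= mul0r add0r.
rewrite [X in _ = _ + X]big_nat_recr //= ltnn mul0r addr0.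
rewrite -big_split /=; apply: eq_big_nat => l /andP[_]; rewrite ltnS => ->.
rewrite /falling big_nat_recr //=.
by ring.
Qed.

Lemma stirling1_exists (R : realType) (mu : R) :
  exists S : nat -> nat -> R, is_stirling1 mu S.
Proof.
have [S HS] := choice (falling_expansion mu (fun j => j%:R * 1)).
by exists S => n x; exact: HS.
Qed.

Lemma whitney1_exists (R : realType) (m : nat) (lambda : R) :
  exists V : nat -> nat -> R, is_whitney1 m lambda V.
Proof.
have [V HV] :=
  choice (falling_expansion lambda (fun j => 1 + m%:R * j%:R)).
exists V => n x; rewrite -HV /falling; elim: n => [|n IH].
  by rewrite !big_geq // mulr1.
rewrite !big_nat_recr //= exprS -IH; ring.
Qed.

(* The polynomials [falling mu x l], [l <= n], are monic of degree [l], so the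
   values [stirling1 mu n l] with [l <= n] are determined by the defining
   identity, and likewise [whitney1 m lambda n k] with [k <= n] when [0 < m].
   The identity says nothing about the values beyond that range. *)
Definition stirling1 (R : realType) (mu : R) : nat -> nat -> R :=
  projT1 (cid (stirling1_exists mu)).

Definition whitney1 (R : realType) (m : nat) (lambda : R) : nat -> nat -> R :=
  projT1 (cid (whitney1_exists m lambda)).

Lemma stirling1P (R : realType) (mu : R) : is_stirling1 mu (stirling1 mu).
Proof. exact: projT2 (cid (stirling1_exists mu)). Qed.

Lemma whitney1P (R : realType) (m : nat) (lambda : R) :
  is_whitney1 m lambda (whitney1 m lambda).
Proof. exact: projT2 (cid (whitney1_exists m lambda)). Qed.

(* Main.v *)
Require Import Defs.
From mathcomp Require Import all_boot all_order all_algebra.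
From mathcomp Require Import reals.
From mathcomp Require Import ring.
Set Implicit Arguments.
Unset Strict Implicit.
Unset Printing Implicit Defensive.
Import Order.TTheory GRing.Theory Num.Theory.
Local Open Scope ring_scope.

(** Expand [m ^ n (x)_n] through the Stirling numbers, rescale
    [m ^ k (x)_(k, lambda / m)] to [(m x)_(k, lambda)], and write
    [m x = (m x + 1) + (-1)] using the Chu-Vandermonde identity for degenerate
    falling factorials. Since the polynomials [(y)_(k, lambda)] are linearly
    independent, the coefficients can be compared with those of the Whitney
    expansion. *)

Lemma falling0 (R : realType) (mu x : R) : falling mu x 0 = 1.
Proof. by rewrite /falling big_geq. Qed.

Lemma fallingS (R : realType) (mu x : R) (n : nat) :
  falling mu x n.+1 = falling mu x n * (x - n%:R * mu).
Proof. by rewrite /falling big_nat_recr. Qed.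

Lemma falling_opp (R : realType) (mu x : R) (n : nat) :
  falling mu (- x) n = (-1) ^+ n * rising mu x n.
Proof.
elim: n => [|n IH]; first by rewrite falling0 /rising big_geq // mulr1.
rewrite fallingS IH /rising big_nat_recr //= exprS; ring.
Qed.

Lemma falling_scale (R : realType) (a mu x : R) (n : nat) :
  falling (a * mu) (a * x) n = a ^+ n * falling mu x n.
Proof.
elim: n => [|n IH]; first by rewrite !falling0 mulr1.
rewrite !fallingS IH exprS; ring.
Qed.

(** Induction on [n]: in the [i]-th term the new factor [x + y - n * mu] splits as
    [(x - i * mu) + (y - (n - i) * mu)], each part extending one of the two falling factorials;
    Pascal's rule then merges the sums. *)
Lemma falling_add (R : realType) (mu x y : R) (n : nat) :
  falling mu (x + y) n
  = \sum_(0 <= i < n.+1) 'C(n, i)%:R * falling mu x i * falling mu y (n - i).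
Proof.
elim: n => [|n IH]; first by rewrite big_nat1 !falling0 bin0 !mulr1.
rewrite fallingS IH mulr_suml.
transitivity (\sum_(0 <= i < n.+1)
    'C(n, i)%:R * falling mu x i.+1 * falling mu y (n - i)
  + \sum_(0 <= i < n.+1)
    'C(n, i)%:R * falling mu x i * falling mu y (n - i).+1).
  rewrite -big_split /=; apply: eq_big_nat => i /andP[_]; rewrite ltnS => le_in.
  rewrite !fallingS -[X in X%:R * mu](subnK le_in) natrD; ring.
rewrite [X in _ + X]big_nat_recl // [RHS]big_nat_recl // !bin0 !subn0.
rewrite addrCA; congr (_ + _).
(* The added term [i = n] is zero because ['C(n, n.+1) = 0]; both sums now share one range. *)
have -> : \sum_(0 <= i < n)
      'C(n, i.+1)%:R * falling mu x i.+1 * falling mu y (n - i.+1).+1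
    = \sum_(0 <= i < n.+1)
      'C(n, i.+1)%:R * falling mu x i.+1 * falling mu y (n - i).
  rewrite [RHS]big_nat_recr //= bin_small // !mul0r addr0.
  by apply: eq_big_nat => i /andP[_ lt_in]; rewrite subnSK.
rewrite -big_split /=; apply: eq_bigr => i _.
rewrite binS natrD subSS; ring.
Qed.

Lemma falling_eq0 (R : realType) (mu : R) (j n : nat) :
  mu != 0 -> (falling mu (j%:R * mu) n == 0) = (j < n)%N.
Proof.
move=> mu0; elim: n => [|n IH]; first by rewrite falling0 oner_eq0.
rewrite fallingS mulf_eq0 IH -mulrBl mulf_eq0 (negPf mu0) orbF subr_eq0.
by rewrite eqr_nat ltnS orbC -leq_eqVlt.
Qed.

(** Evaluating at [0, mu, 2 mu, ...] gives a triangular system with nonzero diagonal, so strong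
    induction recovers the coefficients one by one. *)
Lemma falling_coef_inj (R : realType) (mu : R) (a b : nat -> R) (n : nat) :
  mu != 0 ->
  (forall y, \sum_(0 <= k < n) a k * falling mu y k
           = \sum_(0 <= k < n) b k * falling mu y k) ->
  forall i, (i < n)%N -> a i = b i.
Proof.
move=> mu0 eq_ab; elim/ltn_ind => i IH lt_in.
(* At [y = i * mu] every term of index [> i] vanishes. *)
have trunc c : \sum_(0 <= k < n) c k * falling mu (i%:R * mu) k
    = \sum_(0 <= k < i) c k * falling mu (i%:R * mu) k
      + c i * falling mu (i%:R * mu) i.
  rewrite (@big_cat_nat _ _ _ i.+1) //= [X in _ + X]big1_seq.
    by rewrite addr0 big_nat_recr.
  move=> k /andP[_]; rewrite mem_index_iota => /andP[lt_ik _].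
  by apply/eqP; rewrite mulf_eq0 falling_eq0 // lt_ik orbT.
have := eq_ab (i%:R * mu); rewrite !trunc.
have -> : \sum_(0 <= k < i) a k * falling mu (i%:R * mu) k
        = \sum_(0 <= k < i) b k * falling mu (i%:R * mu) k.
  by apply: eq_big_nat => k /andP[_ lt_ki]; rewrite IH // (ltn_trans lt_ki).
by move/addrI/mulIf; apply; rewrite falling_eq0 // ltnn.
Qed.

Theorem theorem19 (R : realType) (m : nat) (lambda : R)
    (hm : (0 < m)%N) (hlambda : lambda != 0)
    (n i : nat) (hi : (i <= n)%N) :
  whitney1 m lambda n i
  = \sum_(i <= k < n.+1)
      (-1) ^+ (k - i) * ('C(k, i))%:R * m%:R ^+ (n - k)
      * stirling1 (lambda / m%:R) n k * rising lambda 1 (k - i).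
Proof.
have m0 : m%:R != 0 :> R by rewrite pnatr_eq0 -lt0n.
pose t k j : R := (-1) ^+ (k - j) * ('C(k, j))%:R * m%:R ^+ (n - k)
      * stirling1 (lambda / m%:R) n k * rising lambda 1 (k - j).
(* Since ['C(k, j) = 0] for [k < j], the range of [k] no longer depends on [j], which permits the
   later exchange of sums. *)
have tE j : (j <= n)%N ->
    \sum_(j <= k < n.+1) t k j = \sum_(0 <= k < n.+1) t k j.
  move=> le_jn; rewrite [RHS](@big_cat_nat _ _ _ j) //= ?leqW //.
  rewrite [X in _ = X + _]big1_seq ?add0r // => k /andP[_].
  rewrite mem_index_iota => /andP[_ lt_kj].
  by rewrite /t bin_small // mulr0 !mul0r.
rewrite (tE i hi).
apply: (@falling_coef_inj R lambda (whitney1 m lambda n)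
          (fun j => \sum_(0 <= k < n.+1) t k j) n.+1) => // y.
(* This [x] solves [m x + 1 = y], so the Whitney identity reaches every [y]. *)
pose x : R := (y - 1) / m%:R.
have mx : m%:R * x = y - 1 by rewrite /x mulrCA divff // mulr1.
rewrite -[y in LHS](subrK 1) -mx -whitney1P.
rewrite (stirling1P (lambda / m%:R)) mulr_sumr.
under [RHS]eq_bigr do rewrite mulr_suml.
rewrite [RHS]exchange_big /=.
apply: eq_big_nat => k /andP[_]; rewrite ltnS => le_kn.
have fallE : m%:R ^+ k * falling (lambda / m%:R) x k = falling lambda (y - 1) k.
  by rewrite -falling_scale mx mulrCA divff // mulr1.
have powE : m%:R ^+ n = m%:R ^+ (n - k) * m%:R ^+ k :> R.
  by rewrite -exprD subnK.
(* Chu-Vandermonde is applied to [y + (-1)]; only [j <= k] occurs in it, and the terms with [j > k]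
   on the other side vanish. *)
rewrite powE mulrACA fallE falling_add.
rewrite [RHS](@big_cat_nat _ _ _ k.+1) //= [X in _ = _ + X]big1_seq; last first.
  move=> j /andP[_]; rewrite mem_index_iota => /andP[lt_kj _].
  by rewrite /t bin_small // mulr0 !mul0r.
rewrite addr0 mulr_sumr; apply: eq_bigr => j _.
(* The factor at [-1] yields both the sign and [rising lambda 1 (k - j)]. *)
rewrite falling_opp /t; ring.
Qed.
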